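(* Let $j\in\{1,\dots,p\}$, let $\hat\beta$ be the Lasso estimator with tuning parameter $\lambda>0$, and let $\hat\gamma_j$ be obtained by the Lasso of $X_j$ on $X_{-j}$ with tuning parameter $\lambda_j$, with associated $\hat c_j,\hat\tau_j,\tilde\tau_j,\hat\theta_j$ (all defined in the context). Let $\lambda_{j,\epsilon},\lambda_{j,{\rm rem}}\ge 0$ and define the events $$\mathcal T_{j,\epsilon}:=\{|\hat c_j^TX^T\epsilon|/n\le\lambda_{j,\epsilon}\hat\tau_j\},\qquad \mathcal T_{j,{\rm rem}}:=\{\lambda_j\|\hat\beta_{-j}-\beta^0_{-j}\|_1\le\lambda_{j,{\rm rem}}\hat\tau_j\}.$$ Then on $\mathcal T_{j,\epsilon}\cap\mathcal T_{j,{\rm rem}}$ $$|\hat\beta_j-\beta_j^0|\le(\lambda_{j,\epsilon}+\lambda_{j,{\rm rem}})\,\hat\tau_j/\tilde\tau_j^2+\lambda\|\hat\theta_j\|_1 .$$ Moreover, if $\|\hat\gamma_j\|_1<1$ and $\lambda(1-\|\hat\gamma_j\|_1)>(\lambda_{j,\epsilon}+\lambda_{j,{\rm rem}})\hat\tau_j$, then on $\mathcal T_{j,\epsilon}\cap\mathcal T_{j,{\rm rem}}$ $$\Big(\lambda(1-\|\hat\gamma_j\|_1)-(\lambda_{j,\epsilon}+\lambda_{j,{\rm rem}})\hat\tau_j\Big)|\hat\beta_j|\le\Big((\lambda_{j,\epsilon}+\lambda_{j,{\rm rem}})\hat\tau_j+\lambda\|\hat c_j\|_1\Big)|\beta_j^0|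 .$$
   Context: Linear model with fixed design: $Y=X\beta^0+\epsilon$, with $X$ a fixed $n\times p$ real matrix with columns $X_1,\dots,X_p$, $\beta^0\in\mathbb R^p$, $\epsilon\in\mathbb R^n$ a noise vector. For $v\in\mathbb R^n$, $\|v\|_n^2:=v^Tv/n$. The Lasso estimator is a minimizer $\hat\beta\in\arg\min_{\beta\in\mathbb R^p}\{\|Y-X\beta\|_n^2+2\lambda\|\beta\|_1\}$. For a vector $\beta\in\mathbb R^p$, $\beta_{-j}$ is $\beta$ without its $j$-th entry; $X_{-j}$ is $X$ without its $j$-th column. Define, with tuning parameter $\lambda_j\ge 0$, $$\hat\gamma_j\in\arg\min_{\gamma\in\mathbb R^{p-1}}\{\|X_j-X_{-j}\gamma\|_n^2+2\lambda_j\|\gamma\|_1\}$$ (entries indexed by $k\ne j$ and written $\hat\gamma_{k,j}$), $\hat\tau_j^2:=\|X_j-X_{-j}\hat\gamma_j\|_n^2$, $\tilde\tau_j^2:=\hat\tau_j^2+\lambda_j\|\hat\gamma_j\|_1$ (assumed positive), $\hat c_j\in\mathbb R^p$ with $j$-th entry $1$ and $k$-th entry $-\hat\gamma_{k,j}$ for $k\neq j$ (so $X\hat c_j=X_j-X_{-j}\hat\gamma_j$), and $\hat\theta_j:=\hat c_j/\tilde\tau_j^2$. The tuning parameters may depend on the data; ''on an event'' means that the inequality holds whenever the inequalities defining the event hold. *)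

(* Defs.v *)
From mathcomp Require Import all_boot all_order all_algebra.
From mathcomp Require Import reals.

Set Implicit Arguments.
Unset Strict Implicit.
Unset Printing Implicit Defensive.

Import Order.TTheory GRing.Theory Num.Theory.

Local Open Scope ring_scope.

(* Column vectors model R^n and R^p.  For j : 'I_p, [col j X] is X_j, [col' j X]
   is X_{-j} and [row' j b] is b_{-j}; the coordinate k != j of the full vector
   is written k = lift j i with i : 'I_p.-1. *)

Definition sqnormn (R : realType) (n : nat) (v : 'cV[R]_n) : R :=
  (v^T *m v) 0 0 / n%:R.

Definition norm1 (R : realType) (p : nat) (b : 'cV[R]_p) : R :=
  \sum_(k < p) `|b k 0|.

Definition lasso_objective (R : realType) (n p : nat) (X : 'M[R]_(n, p))
    (Y : 'cV[R]_n) (lambda : R) (b : 'cV[R]_p) : R :=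
  sqnormn (Y - X *m b) + 2 * lambda * norm1 b.

(* The minimizer need not be unique, hence a predicate. *)
Definition is_lasso (R : realType) (n p : nat) (X : 'M[R]_(n, p))
    (Y : 'cV[R]_n) (lambda : R) (bhat : 'cV[R]_p) : Prop :=
  forall b : 'cV[R]_p,
    lasso_objective X Y lambda bhat <= lasso_objective X Y lambda b.

Section Nodewise.
Variables (R : realType) (n p : nat) (X : 'M[R]_(n, p)) (j : 'I_p).

Definition is_nodewise_lasso (lambdaj : R) (gamma : 'cV[R]_p.-1) : Prop :=
  is_lasso (col' j X) (col j X) lambdaj gamma.

Definition tau_hat_sq (gamma : 'cV[R]_p.-1) : R :=
  sqnormn (col j X - col' j X *m gamma).

Definition tau_hat (gamma : 'cV[R]_p.-1) : R := Num.sqrt (tau_hat_sq gamma).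

Definition tau_tilde_sq (lambdaj : R) (gamma : 'cV[R]_p.-1) : R :=
  tau_hat_sq gamma + lambdaj * norm1 gamma.

(* [unlift j k] is [None] if k = j, and [Some i] if k = lift j i. *)
Definition c_hat (gamma : 'cV[R]_p.-1) : 'cV[R]_p :=
  \col_k (if unlift j k is Some i then - gamma i 0 else 1).

Definition theta_hat (lambdaj : R) (gamma : 'cV[R]_p.-1) : 'cV[R]_p :=
  (tau_tilde_sq lambdaj gamma)^-1 *: c_hat gamma.

Definition event_eps (gamma : 'cV[R]_p.-1) (eps : 'cV[R]_n)
    (lambda_eps : R) : Prop :=
  `|((c_hat gamma)^T *m X^T *m eps) 0 0| / n%:R <= lambda_eps * tau_hat gamma.

Definition event_rem (lambdaj : R) (gamma : 'cV[R]_p.-1)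
    (bhat beta0 : 'cV[R]_p) (lambda_rem : R) : Prop :=
  lambdaj * norm1 (row' j bhat - row' j beta0) <= lambda_rem * tau_hat gamma.

End Nodewise.

(* Main.v *)
(** Differentiating the Lasso objective along a direction [d] at a minimizer [b]
    with residual [r] gives [<r, X d>_n <= lambda * D] whenever the one-sided
    slope of [norm1] at [b] along [d] is at most [D].  For the nodewise Lasso
    this yields, for [c = c_hat], [|<X c, X_{-j} d>_n| <= lambdaj * norm1 d] and
    [<X c, X_j>_n = tau_tilde^2], so [<X c, r>_n] expands into
    [- tau_tilde^2 (bhat_j - beta0_j)] plus the noise and remainder terms.
    Along [c] itself the Lasso gives [|<X c, r>_n| <= lambda * norm1 c], hence the
    first bound.  If [bhat_j != 0], moving towards zero along [c] decreases
    [norm1] at rate at least [1 - norm1 gamma]; this forces [bhat_j - beta0_j] to have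
    sign opposite to [bhat_j], whence [|bhat_j| <= |beta0_j|], and the second bound
    follows since its left coefficient is at most its right one. *)

Require Import Defs.
From mathcomp Require Import all_boot all_order all_algebra.
From mathcomp Require Import reals ring lra.

Set Implicit Arguments.
Unset Strict Implicit.
Unset Printing Implicit Defensive.

Import Order.TTheory GRing.Theory Num.Theory.

Local Open Scope ring_scope.

Section InnerProduct.
Variables (R : realType) (n : nat).
Implicit Types (u v w : 'cV[R]_n) (a : R).

Definition dotn u v : R := (u^T *m v) 0 0 / n%:R.

Lemma dotnC u v : dotn u v = dotn v u.
Proof.
by rewrite /dotn -[u in RHS]trmxK -trmx_mul [in RHS]mxE.
Qed.

Lemma dotnDr u v w : dotn u (v + w) = dotn u v + dotn u w.
Proof. by rewrite /dotn mulmxDr mxE mulrDl. Qed.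

Lemma dotnZr a u v : dotn u (a *: v) = a * dotn u v.
Proof. by rewrite /dotn -scalemxAr mxE mulrA. Qed.

Lemma dotnNr u v : dotn u (- v) = - dotn u v.
Proof. by rewrite -scaleN1r dotnZr mulN1r. Qed.

Lemma dotnBr u v w : dotn u (v - w) = dotn u v - dotn u w.
Proof. by rewrite dotnDr dotnNr. Qed.

Lemma sqnormnE v : sqnormn v = dotn v v.
Proof. by []. Qed.

Lemma sqnormn_ge0 v : 0 <= sqnormn v.
Proof.
rewrite divr_ge0 // mxE sumr_ge0 // => i _.
by rewrite mxE -expr2 sqr_ge0.
Qed.

Lemma sqnormnBZ a u v :
  sqnormn (u - a *: v) = sqnormn u - 2 * a * dotn u v + a ^+ 2 * sqnormn v.
Proof.
rewrite !sqnormnE dotnBr dotnZr (dotnC _ u) (dotnC _ v) !dotnBr !dotnZr.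
by rewrite (dotnC v u); ring.
Qed.

End InnerProduct.

Section Norm1.
Variables (R : realType) (p : nat).
Implicit Types (b d : 'cV[R]_p) (a : R).

Lemma norm1_ge0 b : 0 <= norm1 b.
Proof. exact: sumr_ge0. Qed.

Lemma norm1Z a b : norm1 (a *: b) = `|a| * norm1 b.
Proof. by rewrite /norm1 mulr_sumr; apply: eq_bigr => k _; rewrite mxE normrM. Qed.

Lemma norm1N b : norm1 (- b) = norm1 b.
Proof. by rewrite -scaleN1r norm1Z normrN1 mul1r. Qed.

Lemma ler_norm1D b d : norm1 (b + d) <= norm1 b + norm1 d.
Proof. by rewrite /norm1 -big_split ler_sum // => k _; rewrite mxE ler_normD. Qed.

Lemma norm1_row' (j : 'I_p) b : norm1 b = `|b j 0| + norm1 (row' j b).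
Proof.
rewrite /norm1 (bigD1_ord j) //=; congr (_ + _).
by apply: eq_bigr => i _; rewrite mxE.
Qed.

End Norm1.

Lemma mulmx_col_row' (R : realType) (n p : nat) (X : 'M[R]_(n, p)) (j : 'I_p)
    (b : 'cV[R]_p) :
  X *m b = b j 0 *: col j X + col' j X *m row' j b.
Proof.
apply/matrixP => i k; rewrite (ord1 k) !mxE (bigD1_ord j) //= mulrC.
by congr (_ + _); apply: eq_bigr => l _; rewrite !mxE.
Qed.

(** Dividing by [t] gives [a <= t * q], and [t] may tend to 0. *)
Lemma linear_le_quadratic_le0 (R : realType) (a q e : R) :
  0 < e -> 0 <= q -> (forall t, 0 < t <= e -> t * a <= t ^+ 2 * q) -> a <= 0.
Proof.
move=> e0 q0 H; rewrite leNgt; apply/negP => a0.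
have q1 : 0 < q + 1 by lra.
(* If [a > 0], this [t] satisfies [t * q + t <= a], contradicting [a <= t * q]; the denominator
   [q + 1] stays positive even when [q = 0]. *)
have t0 : 0 < Num.min e (a / (q + 1)) by rewrite lt_min e0 divr_gt0.
have /H : 0 < Num.min e (a / (q + 1)) <= e by rewrite t0 ge_min lexx.
rewrite expr2 -mulrA ler_pM2l //.
have : Num.min e (a / (q + 1)) * (q + 1) <= a.
  by rewrite -ler_pdivlMr // ge_min lexx orbT.
by rewrite mulrDr mulr1; lra.
Qed.

Section LassoOptimality.
Variables (R : realType) (n p : nat) (X : 'M[R]_(n, p)) (Y : 'cV[R]_n).
Variables (lambda : R) (b : 'cV[R]_p).
Hypotheses (lambda_ge0 : 0 <= lambda) (b_lasso : is_lasso X Y lambda b).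

(** Compare the objective at [b] with that at [b + t *: d]: the squared loss is linear in [t] up to
    [t ^+ 2 * sqnormn (X *m d)]. Restricting to [t <= e] allows slopes of [norm1] that hold only
    until a coordinate changes sign. *)
Lemma lasso_slope (d : 'cV[R]_p) (D e : R) : 0 < e ->
  (forall t, 0 < t <= e -> norm1 (b + t *: d) <= norm1 b + t * D) ->
  dotn (Y - X *m b) (X *m d) <= lambda * D.
Proof.
move=> e0 slope; rewrite -subr_le0.
suff : 2 * (dotn (Y - X *m b) (X *m d) - lambda * D) <= 0 by lra.
apply: (linear_le_quadratic_le0 e0 (sqnormn_ge0 (X *m d))) => t te.
have := b_lasso (b + t *: d).
rewrite /lasso_objective mulmxDr -scalemxAr opprD addrA sqnormnBZ.
have := ler_wpM2l lambda_ge0 (slope t te).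
by rewrite mulrDr; lra.
Qed.

Lemma lasso_dot_le (d : 'cV[R]_p) :
  `|dotn (Y - X *m b) (X *m d)| <= lambda * norm1 d.
Proof.
have le d' : dotn (Y - X *m b) (X *m d') <= lambda * norm1 d'.
  apply: (lasso_slope ltr01) => t /andP[t0 _].
  by rewrite (le_trans (ler_norm1D _ _)) // norm1Z gtr0_norm.
rewrite ler_norml; apply/andP; split; last exact: le.
by rewrite lerNl; have := le (- d); rewrite mulmxN dotnNr norm1N.
Qed.

Lemma lasso_dot_fit : dotn (Y - X *m b) (X *m b) = lambda * norm1 b.
Proof.
apply/eqP; rewrite eq_le; apply/andP; split.
  by apply: le_trans (ler_norm _) (lasso_dot_le _).
(* Along [- b] the point is [(1 - t) *: b], so for [t <= 1] the norm falls at rate exactly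
   [norm1 b]. *)
suff : dotn (Y - X *m b) (X *m - b) <= lambda * - norm1 b.
  by rewrite mulmxN dotnNr mulrN lerN2.
apply: (lasso_slope ltr01) => t /andP[t0 t1].
have -> : b + t *: - b = (1 - t) *: b by rewrite scalerN scalerBl scale1r.
by rewrite norm1Z ger0_norm ?subr_ge0 // mulrBl mul1r mulrN.
Qed.

Lemma lasso_dot_active (j : 'I_p) (c : 'cV[R]_p) : b j 0 != 0 -> c j 0 = 1 ->
  lambda * (1 - norm1 (row' j c))
    <= Num.sg (b j 0) * dotn (Y - X *m b) (X *m c).
Proof.
(* In this direction coordinate [j] shrinks at unit rate until it reaches 0 at [t = |b_j|], while
   the other coordinates add at most [t * norm1 (row' j c)]. *)
move=> bj0 cj1; suff : dotn (Y - X *m b) (X *m (- Num.sg (b j 0) *: c))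
         <= lambda * - (1 - norm1 (row' j c)).
  by rewrite -scalemxAr dotnZr mulNr mulrN lerN2.
have bj_gt0 : 0 < `|b j 0| by rewrite normr_gt0.
apply: (lasso_slope bj_gt0) => t /andP[t0 tb].
rewrite 2!(norm1_row' j) !mxE cj1 mulr1.
have -> : `|b j 0 + t * - Num.sg (b j 0)| = `|b j 0| - t.
  rewrite {1}[b j 0]numEsg mulrN (mulrC t) -mulrBr normrM normr_sg bj0 mul1r.
  by rewrite ger0_norm // subr_ge0.
have : norm1 (row' j (b + t *: (- Num.sg (b j 0) *: c)))
         <= norm1 (row' j b) + t * norm1 (row' j c).
  have -> : row' j (b + t *: (- Num.sg (b j 0) *: c))
          = row' j b + (t * - Num.sg (b j 0)) *: row' j c.
    by apply/matrixP => i k; rewrite !mxE mulrA.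
  rewrite (le_trans (ler_norm1D _ _)) // norm1Z normrM normrN normr_sg bj0.
  by rewrite mulr1 gtr0_norm.
by lra.
Qed.

End LassoOptimality.

Section Nodewise.
Variables (R : realType) (n p : nat) (X : 'M[R]_(n, p)) (j : 'I_p).
Variables (lambdaj : R) (gamma : 'cV[R]_p.-1).

Lemma c_hat_diag : c_hat j gamma j 0 = 1.
Proof. by rewrite mxE unlift_none. Qed.

Lemma row'_c_hat : row' j (c_hat j gamma) = - gamma.
Proof. by apply/matrixP => i k; rewrite !mxE liftK (ord1 k). Qed.

Lemma norm1_c_hat : norm1 (c_hat j gamma) = 1 + norm1 gamma.
Proof. by rewrite (norm1_row' j) c_hat_diag row'_c_hat normr1 norm1N. Qed.

Lemma mulmx_c_hat : X *m c_hat j gamma = col j X - col' j X *m gamma.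
Proof. by rewrite (mulmx_col_row' X j) c_hat_diag row'_c_hat scale1r mulmxN. Qed.

Hypotheses (lambdaj_ge0 : 0 <= lambdaj)
  (gamma_lasso : is_nodewise_lasso X j lambdaj gamma).

(** Write [X_j] as nodewise residual plus fit; [lasso_dot_fit] evaluates the cross term as
    [lambdaj * norm1 gamma]. *)
Lemma dotn_c_hat_col :
  dotn (X *m c_hat j gamma) (col j X) = tau_tilde_sq X j lambdaj gamma.
Proof.
rewrite mulmx_c_hat /tau_tilde_sq /tau_hat_sq.
rewrite -(lasso_dot_fit lambdaj_ge0 gamma_lasso) sqnormnE -dotnDr.
by rewrite subrK.
Qed.

(** Column [j] of [X *m d] contributes exactly the subtracted term, so only the product of the
    nodewise residual with [X_{-j} d_{-j}] remains. *)
Lemma dotn_c_hat_mulmx (d : 'cV[R]_p) :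
  `|dotn (X *m c_hat j gamma) (X *m d) - tau_tilde_sq X j lambdaj gamma * d j 0|
    <= lambdaj * norm1 (row' j d).
Proof.
rewrite (mulmx_col_row' X j d) dotnDr dotnZr dotn_c_hat_col mulrC addrC addKr.
by rewrite mulmx_c_hat lasso_dot_le.
Qed.

End Nodewise.

Theorem lemma2p1 (R : realType) (n p : nat)
    (X : 'M[R]_(n, p)) (beta0 : 'cV[R]_p) (eps Y : 'cV[R]_n)
    (hY : Y = X *m beta0 + eps)
    (j : 'I_p)
    (lambda : R) (hlambda : 0 < lambda)
    (bhat : 'cV[R]_p) (hbhat : is_lasso X Y lambda bhat)
    (lambdaj : R) (hlambdaj : 0 <= lambdaj)
    (gamma : 'cV[R]_p.-1) (hgamma : is_nodewise_lasso X j lambdaj gamma)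
    (htau : 0 < tau_tilde_sq X j lambdaj gamma)
    (lambda_eps lambda_rem : R)
    (hlambda_eps : 0 <= lambda_eps) (hlambda_rem : 0 <= lambda_rem) :
  (event_eps X j gamma eps lambda_eps ->
   event_rem X j lambdaj gamma bhat beta0 lambda_rem ->
   `|bhat j 0 - beta0 j 0|
     <= (lambda_eps + lambda_rem) * tau_hat X j gamma
          / tau_tilde_sq X j lambdaj gamma
        + lambda * norm1 (theta_hat X j lambdaj gamma))
  /\
  (norm1 gamma < 1 ->
   (lambda_eps + lambda_rem) * tau_hat X j gamma
     < lambda * (1 - norm1 gamma) ->
   event_eps X j gamma eps lambda_eps ->
   event_rem X j lambdaj gamma bhat beta0 lambda_rem ->
   (lambda * (1 - norm1 gamma)
      - (lambda_eps + lambda_rem) * tau_hat X j gamma) * `|bhat j 0|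
     <= ((lambda_eps + lambda_rem) * tau_hat X j gamma
           + lambda * norm1 (c_hat j gamma)) * `|beta0 j 0|).
Proof.
set A := (lambda_eps + lambda_rem) * tau_hat X j gamma.
set T := tau_tilde_sq X j lambdaj gamma.
set c := c_hat j gamma; set r := Y - X *m bhat.
have A_ge0 : 0 <= A by rewrite mulr_ge0 ?addr_ge0 ?sqrtr_ge0.
have lambda_ge0 := ltW hlambda.
(* With [d = bhat - beta0] and [r = eps - X d], the sum equals
   [<X c, eps>_n - (<X c, X d>_n - T d_j)]; each event controls one term. *)
have residual : event_eps X j gamma eps lambda_eps ->
    event_rem X j lambdaj gamma bhat beta0 lambda_rem ->
    `|T * (bhat j 0 - beta0 j 0) + dotn r (X *m c)| <= A.
  rewrite /event_eps /event_rem => Heps Hrem.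
  have {}Heps : `|dotn (X *m c) eps| <= lambda_eps * tau_hat X j gamma.
    by rewrite /dotn trmx_mul normrM normfV normr_nat.
  have := dotn_c_hat_mulmx hlambdaj hgamma (bhat - beta0).
  have -> : row' j (bhat - beta0) = row' j bhat - row' j beta0.
    by apply/matrixP => i k; rewrite !mxE.
  move=> /le_trans /(_ Hrem); rewrite -/c -/T !mxE.
  have -> : r = eps - X *m (bhat - beta0).
    by rewrite /r hY mulmxBr opprB addrC addrA addrC [X *m _ - _ in RHS]addrC addrA.
  rewrite [dotn (_ - _) _]dotnC dotnBr => Hrem'.
  move: Heps Hrem'; rewrite /A !ler_norml mulrDl.
  by move=> /andP[? ?] /andP[? ?]; apply/andP; split; lra.
have dot_le : `|dotn r (X *m c)| <= lambda * norm1 c by exact: lasso_dot_le.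
split=> [Heps Hrem | gamma_lt1 B_gt0 Heps Hrem].
  rewrite norm1Z normfV (gtr0_norm htau) -/T -/c [_^-1 * _]mulrC mulrA -mulrDl.
  (* After multiplying by [T], the triangle inequality combines [residual] and [dot_le]. *)
  rewrite ler_pdivlMr // mulrC -[X in X * _](gtr0_norm htau) -normrM.
  have -> : T * (bhat j 0 - beta0 j 0)
          = T * (bhat j 0 - beta0 j 0) + dotn r (X *m c) - dotn r (X *m c).
    by rewrite addrK.
  by rewrite (le_trans (ler_normB _ _)) // lerD // residual.
have g0 := norm1_ge0 gamma.
have [bj0 | bj_neq0] := eqVneq (bhat j 0) 0.
  by rewrite bj0 normr0 mulr0 mulr_ge0 // addr_ge0 // mulr_ge0 // norm1_ge0.
have := lasso_dot_active lambda_ge0 hbhat bj_neq0 (c_hat_diag j gamma).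
rewrite row'_c_hat norm1N -/r -/c => active.
set s := Num.sg (bhat j 0) in active.
have s1 : `|s| = 1 by rewrite normr_sg bj_neq0.
have le_abs : `|bhat j 0| <= `|beta0 j 0|.
  have : s * (T * (bhat j 0 - beta0 j 0) + dotn r (X *m c)) <= A.
    by rewrite (le_trans (ler_norm _)) // normrM s1 mul1r residual.
  rewrite mulrDr mulrCA => le_A.
  (* By [active] and [B_gt0], the term [s * dotn r (X *m c)] alone exceeds [A]. *)
  have : T * (s * (bhat j 0 - beta0 j 0)) <= 0 by lra.
  rewrite pmulr_rle0 // mulrBr -normrEsg subr_le0 => /le_trans; apply.
  by rewrite (le_trans (ler_norm _)) // normrM s1 mul1r.
apply: ler_pM => //; first by lra.
rewrite norm1_c_hat.
have : 0 <= lambda * norm1 gamma by rewrite mulr_ge0.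
by lra.
Qed.
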